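(* Let $M$ be a loopless matroid on $E=\{0,1,\dots,n\}$ and let $S$ be a nonempty subset of $E$. Let $H_S$ be the matroid on $E$ whose bases are $\{E\setminus i : i\in S\}$, and let $F=\operatorname{cl}_M(S)$ be the smallest flat of $M$ containing $S$. Then $H_S\wedge M=T_F(M)$, and the divisor class $h_S\in A^1(\Sigma_{A_n})$ satisfies \[ h_S\cap\Delta_M=\begin{cases}\Delta_{T_F(M)} & \text{if } \operatorname{rk}_M(S)>1,\\ 0 & \text{otherwise.}\end{cases} \]
   Context: Let $N=\mathbb Z^E/\mathbb Z\mathbf e_E$ where $\mathbf e_S=\sum_{i\in S}\mathbf e_i$, and let $u_S$ be the image of $\mathbf e_S$ in $N$. The braid fan $\Sigma_{A_n}\subset N_{\mathbb R}$ is the complete smooth fan whose cones are $\operatorname{Cone}(u_{S_1},\dots,u_{S_k})$ for chains $\emptyset\subsetneq S_1\subsetneq\cdots\subsetneq S_k\subsetneq E$. For a smooth fan $\Sigma$, its Chow ring is $A^\bullet(\Sigma)=\mathbb R[x_\rho:\rho\in\Sigma(1)]/(\langle\prod_{\rho\in T}x_\rho : T \text{ not a cone}\rangle+\langle\sum_\rho m(u_\rho)x_\rho : m\in N^\vee\rangle)$; for $\Sigma_{A_n}$ write $x_T$ for the variable of the ray $u_T$. An $\ell$-dimensional Minkowski weight is a function $\Delta:\Sigma(\ell)\to\mathbb R$ such that for each $\tau\in\Sigma(\ell-1)$, $\sum_{\sigma\succ\tau}\Delta(\sigma)u_{\sigma\setminus\tau}\in\operatorname{span}(\tau)$; they form $\operatorname{MW}_\ell(\Sigma)$.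 Every element of $A^\ell(\Sigma)$ is a linear combination of monomials $\prod_{\rho\in\sigma}x_\rho$ ($\sigma\in\Sigma(\ell)$), and for $\Delta\in \operatorname{MW}_\ell(\Sigma)$ the rule $\prod_{\rho\in\sigma}x_\rho\mapsto\Delta(\sigma)$ gives a well-defined linear functional on $A^\ell(\Sigma)$. The cap product $\xi\cap\Delta\in\operatorname{MW}_{\ell-k}(\Sigma)$ of $\xi\in A^k(\Sigma)$ and $\Delta\in\operatorname{MW}_\ell(\Sigma)$ is $\sigma\mapsto$ (this functional of $\Delta$ applied to $\xi\cdot\prod_{\rho\in\sigma}x_\rho$). Let $\alpha=\sum_{i\in T\subsetneq E}x_T\in A^1(\Sigma_{A_n})$ (independent of $i$), and for nonempty $S\subseteq E$ put $h_S=\alpha-\sum_{S\subseteq T\subsetneq E}x_T\in A^1(\Sigma_{A_n})$. For a loopless matroid $M$ of rank $d+1$ on $E$, its Bergman class $\Delta_M\in\operatorname{MW}_d(\Sigma_{A_n})$ takes value $1$ on $\operatorname{Cone}(u_{F_1},\dots,u_{F_d})$ when all $F_i$ are flats of $M$, and $0$ otherwise. The principal truncation $T_F(M)$ is the matroid with bases $\{B\setminus f: B \text{ a basis of } M,\ f\in B\cap F\}$. The matroid intersection $M\wedge N$ of matroids on $E$ is the matroid whose spanning sets are $\{S\cap S': S \text{ spanning in } M, S' \text{ spanning in } N\}$. *)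

(* Defs.v *)
From HB Require Import structures.
From mathcomp Require Import all_boot all_order all_algebra.
From mathcomp Require Import mpoly.

Set Implicit Arguments.
Unset Strict Implicit.
Unset Printing Implicit Defensive.

Import Order.TTheory GRing.Theory Num.Theory.
Local Open Scope ring_scope.

Section Matroids.
Variable T : finType.
Implicit Types (Bs : {set {set T}}) (A X Y : {set T}).

Definition is_matroid Bs : Prop :=
  Bs != set0 /\
  forall X Y, X \in Bs -> Y \in Bs -> forall x, x \in X :\: Y ->
    exists2 y, y \in Y :\: X & y |: (X :\ x) \in Bs.

Definition mrank Bs A : nat := \max_(X in Bs) #|A :&: X|.

Definition loopless Bs : Prop := forall e : T, exists2 X, X \in Bs & e \in X.

Definition flat Bs A : bool :=
  [forall e, (e \notin A) ==> (mrank Bs A < mrank Bs (e |: A))%N].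

Definition mclosure Bs A : {set T} :=
  \bigcap_(F : {set T} | flat Bs F && (A \subset F)) F.

Definition spanning Bs A : bool := [exists X in Bs, X \subset A].

Definition H_bases (S : {set T}) : {set {set T}} := [set ~: [set i] | i in S].

Definition trunc_bases Bs (F : {set T}) : {set {set T}} :=
  [set X :\ f | X in Bs, f in X :&: F].

Definition meet_spanning Bs1 Bs2 : {set {set T}} :=
  [set A1 :&: A2 | A1 in [set A | spanning Bs1 A], A2 in [set A | spanning Bs2 A]].

End Matroids.

(* We work in the polynomial ring R[x_T : T subset of E], variables    *)
(* indexed by all subsets T (via enum_rank).  The two non-ray          *)
(* variables x_set0 and x_setT are put into the ideal, so the quotient *)
(* is exactly A^*(Sigma_{A_n}).                                        *)
Section Chow.
Variables (R : nzRingType) (n : nat).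
Local Notation E := 'I_n.+1.
Local Notation k := #|{set E}|.
Local Notation P := {mpoly R[k]}.

Definition xv (T : {set E}) : P := 'X_(enum_rank T).

Definition ray (T : {set E}) : bool := (T != set0) && (T != setT).

Definition is_cone (sg : {set {set E}}) : bool :=
  [forall T in sg, ray T] &&
  [forall T in sg, forall T' in sg, (T \subset T') || (T' \subset T)].

Definition xmono (sg : {set {set E}}) : P := \prod_(T in sg) xv T.

Definition chow_gen (g : P) : Prop :=
  (exists tau : {set {set E}},
      [forall T in tau, ray T] && ~~ is_cone tau /\ g = xmono tau)
  \/ (exists m : E -> int, \sum_(j : E) m j = 0 /\
        g = \sum_(T : {set E} | ray T) ((\sum_(j in T) m j)%:~R) *: xv T)
  \/ g = xv set0 \/ g = xv setT.

Definition in_chow_ideal (p : P) : Prop :=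
  exists s : seq (P * P),
    (forall q, q \in s -> chow_gen q.2) /\ p = \sum_(q <- s) q.1 * q.2.

Definition homog_deg (d : nat) (p : P) : bool :=
  all [pred m | mdeg m == d] (msupp p).

(* L is the linear functional on A^d(Sigma) induced by the weight
   Delta : Sigma(d) -> R, i.e. x_sigma |-> Delta(sigma), (lifted to the
   polynomial ring; it vanishes on the degree-d part of the ideal). *)
Definition weight_functional (Delta : {set {set E}} -> R) (d : nat)
    (L : P -> R) : Prop :=
  (forall a p q, L (a *: p + q) = a * L p + L q) /\
  (forall p, in_chow_ideal p -> homog_deg d p -> L p = 0) /\
  (forall sg, is_cone sg -> #|sg| = d -> L (xmono sg) = Delta sg).

Definition alpha (i : E) : P := \sum_(T : {set E} | (i \in T) && (T != setT)) xv T.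

Definition hdiv (S : {set E}) (i : E) : P :=
  alpha i - \sum_(T : {set E} | (S \subset T) && (T != setT)) xv T.

(* Bergman class of a matroid (value on a cone of the right dimension) *)
Definition bergman (Bs : {set {set E}}) (sg : {set {set E}}) : R :=
  if [forall F in sg, flat Bs F] then 1 else 0.

End Chow.

(* Main.v *)
Require Import Defs.
From HB Require Import structures.
From mathcomp Require Import all_boot all_order all_algebra.
From mathcomp Require Import mpoly zify.
Import Order.TTheory GRing.Theory Num.Theory.
Local Open Scope ring_scope.

(* The rank function of T_F(M) is rk A - [F subset of cl A], so the flats of
   T_F(M) are the flats G of M with S contained in G or rk (G u S) >= rk G + 2.

   Given a chain sg of d - 1 sets, let G be its largest member (or the empty
   set) not containing S, and pick a in S outside G. Modulo the ideal, h_S is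
   the sum of the x_T with a in T and S not contained in T, and no such T lies in
   sg. Hence the value of h_S cap Delta_M at sg is the number of such T that
   extend sg to a complete flag of flats of M. For rank reasons
   T = cl (G u a) is the only candidate, and it is one iff S is not contained in
   cl (G u a), i.e. iff rk S > 1 and all members of sg are flats of T_F(M). *)

(** * Rank, closure and flats of a matroid given by its bases *)

Lemma leq_mrank {T : finType} {Bs : {set {set T}}} (A : {set T}) {B : {set T}} :
  B \in Bs -> (#|A :&: B| <= mrank Bs A)%N.
Proof.
exact: (leq_bigmax_cond (P := mem Bs) (F := fun X : {set T} => #|A :&: X|)).
Qed.

Section MatroidRank.
Set Implicit Arguments.
Unset Strict Implicit.
Local Open Scope nat_scope.
Variables (T : finType) (Bs : {set {set T}}).
Hypothesis HM : is_matroid Bs.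
Implicit Types A B I X Y G : {set T}.
Local Notation rk := (mrank Bs).

Lemma basis_exchange B1 B2 x : B1 \in Bs -> B2 \in Bs -> x \in B1 -> x \notin B2 ->
  exists y, [/\ y \in B2, y \notin B1 & y |: B1 :\ x \in Bs].
Proof.
move=> b1 b2 x1 x2; case: HM => _ /(_ _ _ b1 b2 x).
by rewrite inE x1 x2 => /(_ isT) [y]; rewrite inE => /andP[y1 y2] yB; exists y.
Qed.

(** Among the bases containing [I], take one with the fewest elements outside [I :|: B2]. Exchanging
    such an element against [B2] would keep [I] and lower the count. *)
Lemma basis_extension I B1 B2 : B1 \in Bs -> I \subset B1 -> B2 \in Bs ->
  exists B, [/\ B \in Bs, I \subset B & B \subset I :|: B2].
Proof.
move=> b1 I1 b2.
pose ext B := (B \in Bs) && (I \subset B).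
have P1 : ext B1 by rewrite /ext b1.
case: (arg_minnP (fun B => #|B :\: (I :|: B2)|) P1) => B /andP[bB IB] minB.
exists B; split=> //; rewrite -setD_eq0; apply/negPn/negP => /set0Pn[x].
rewrite !inE negb_or => /andP[/andP[xI x2] xB].
have [y [y2 yB yBs]] := basis_exchange bB b2 xB x2.
have Iy : I \subset y |: B :\ x.
  apply/subsetP=> z zI; rewrite !inE (subsetP IB) // andbT.
  by case: (z =P x) zI xI => [->->|_ _ _]; rewrite ?orbT.
have:= minB (y |: B :\ x); rewrite /ext yBs Iy => /(_ isT); rewrite leqNgt => /negP; apply.
apply: proper_card; apply/properP; split.
  apply/subsetP=> z; rewrite !inE negb_or => /andP[/andP[zI z2]].
  by case/orP=> [/eqP zy|/andP[_ ->]]; [rewrite zy y2 in z2 | rewrite zI z2].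
exists x; first by rewrite !inE negb_or xI x2.
rewrite !inE eqxx /= orbF negb_and; apply/orP; right.
by apply: contraNneq yB => <-.
Qed.

(** Induction on [#|B1 :\: B2|]: an exchange preserves the size of [B1] and shrinks the difference.
    In the base case [B1] lies in [B2], and a proper inclusion would leave nothing to exchange. *)
Lemma card_basis B1 B2 : B1 \in Bs -> B2 \in Bs -> #|B1| = #|B2|.
Proof.
move: {2}(#|B1 :\: B2|) (leqnn #|B1 :\: B2|) => k.
elim: k B1 => [|k IH] B1 + b1 b2.
  rewrite leqn0 cards_eq0 setD_eq0 => s12; congr #|pred_of_set _|.
  apply/eqP; rewrite eqEsubset s12; apply/subsetP=> y y2; apply/negPn/negP => y1.
  by have [x [x1 x2 _]] := basis_exchange b2 b1 y2 y1; rewrite (subsetP s12) in x2.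
move=> lek; have [/eqP|[x]] := set_0Vmem (B1 :\: B2).
  by rewrite -cards_eq0 => /eqP d0; apply: IH => //; rewrite d0.
move=> xD; move: (xD); rewrite inE => /andP[x2 x1].
have [y [y2 y1 yBs]] := basis_exchange b1 b2 x1 x2.
rewrite -(IH _ _ yBs b2) ?cardsU1 ?inE ?(negPf y1) ?andbF; last first.
  rewrite -ltnS; apply: leq_trans lek; apply: proper_card.
  apply/properP; split; last first.
    exists x => //; rewrite !inE eqxx /= orbF negb_and; apply/orP; right.
    by apply: contraNneq y1 => <-.
  apply/subsetP=> z; rewrite !inE => /andP[z2 /orP[/eqP zy|/andP[_ ->]]].
    by rewrite zy y2 in z2.
  by rewrite z2.
by rewrite (cardsD1 x B1) x1.
Qed.

Lemma card_capD_basis A B1 B2 : B1 \in Bs -> B2 \in Bs ->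
  #|A :&: B1| + #|B1 :\: A| = #|A :&: B2| + #|B2 :\: A|.
Proof. by move=> b1 b2; rewrite ![A :&: _]setIC !cardsID (card_basis b1 b2). Qed.

Lemma mrank_attained A : exists2 B, B \in Bs & #|A :&: B| = rk A.
Proof.
case: HM => /set0Pn[B0 b0] _.
have c0 : 0 < #|Bs| by apply/card_gt0P; exists B0.
by have [B bB e] := eq_bigmax_cond (fun X : {set T} => #|A :&: X|) c0; exists B.
Qed.

(** Extend [I] by elements of an optimal basis [B0]. Since [I] lies in [A], the new basis has no
    more elements outside [A] than [B0], hence at least as many inside. *)
Lemma mrank_attained_extension I A B1 : B1 \in Bs -> I \subset B1 -> I \subset A ->
  exists B, [/\ B \in Bs, I \subset B & #|A :&: B| = rk A].
Proof.
move=> b1 I1 IA; have [B0 b0 r0] := mrank_attained A.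
have [B [bB IB sB]] := basis_extension b1 I1 b0.
exists B; split=> //; apply/eqP; rewrite eqn_leq leq_mrank //=.
have e := card_capD_basis A bB b0.
have le : #|B :\: A| <= #|B0 :\: A|.
  apply/subset_leq_card/subsetP => z; rewrite !inE => /andP[zA zB]; rewrite zA.
  by have /subsetP/(_ z zB) := sB; rewrite inE => /orP[/(subsetP IA)|//]; rewrite (negPf zA).
by rewrite -r0 -(leq_add2r #|B :\: A|) e leq_add2l.
Qed.

Lemma mrank_attained2 A A' : A \subset A' ->
  exists B, [/\ B \in Bs, #|A :&: B| = rk A & #|A' :&: B| = rk A'].
Proof.
move=> sAA'; have [B0 b0 r0] := mrank_attained A.
have [|B [bB IB rB]] := mrank_attained_extension b0 (subsetIr A B0) (A := A').
  by rewrite (subset_trans _ sAA') // subsetIl.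
exists B; split=> //; apply/eqP; rewrite eqn_leq leq_mrank //= -r0.
by apply: subset_leq_card; rewrite subsetI subsetIl.
Qed.

Lemma mrankS A A' : A \subset A' -> rk A <= rk A'.
Proof.
move=> s; have [B bB <-] := mrank_attained A.
by apply: leq_trans (leq_mrank A' bB); apply/subset_leq_card/setSI.
Qed.

(** One basis computes the rank of both the intersection and the union. Its traces on [X] and [Y]
    have the same total size and are bounded by the ranks. *)
Lemma mrank_submod X Y : rk (X :|: Y) + rk (X :&: Y) <= rk X + rk Y.
Proof.
have [|B [bB <- <-]] := @mrank_attained2 (X :&: Y) (X :|: Y).
  by rewrite subIset // subsetUl.
rewrite setIUl setIIl cardsUI.
by rewrite leq_add // leq_mrank.
Qed.

Lemma mrank0 : rk set0 = 0.
Proof. by have [B _ <-] := mrank_attained set0; rewrite set0I cards0. Qed.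

Lemma mrank_le_card A : rk A <= #|A|.
Proof. by have [B _ <-] := mrank_attained A; apply/subset_leq_card/subsetIl. Qed.

Lemma mrankU1 e A : rk (e |: A) <= (rk A).+1.
Proof.
apply: leq_trans (_ : rk [set e] + rk A <= _).
  by apply: leq_trans (mrank_submod _ _); apply: leq_addr.
by rewrite -add1n leq_add2r (leq_trans (mrank_le_card _)) // cards1.
Qed.

(** Diminishing returns: submodularity for [X :|: Z] and [Y], whose intersection contains [X]. *)
Lemma mrankU_incr X Y Z : X \subset Y -> rk (Y :|: Z) + rk X <= rk (X :|: Z) + rk Y.
Proof.
move=> s; apply: leq_trans (mrank_submod _ _).
by rewrite -setUA [Z :|: Y]setUC setUA (setUidPr s) leq_add2l mrankS // subsetI subsetUl s.
Qed.

(** Take a basis optimal for both [A] and [A :|: Y]. If it contained some [y] of [Y] outside [A],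
    its trace on [y |: A] would exceed [rk A]. *)
Lemma mrank_spanned A Y : {in Y, forall e, rk (e |: A) <= rk A} -> rk (A :|: Y) = rk A.
Proof.
move=> H; apply/eqP; rewrite eqn_leq [X in _ && X]mrankS ?subsetUl // andbT.
have [B [bB rA rAY]] := mrank_attained2 (subsetUl A Y).
rewrite -rAY -rA; apply/subset_leq_card/subsetP=> y.
rewrite !inE => /andP[/orP[->->//|yY] yB]; rewrite yB andbT.
apply/negPn/negP=> yA; have := leq_trans (leq_mrank (y |: A) bB) (H y yY).
rewrite -rA setIUl (setIidPl _) ?sub1set // cardsU1 inE (negPf yA) /=.
by rewrite add1n ltnn.
Qed.

(** Closure in terms of rank, so that membership is an inequality; [mclosureE] identifies it with
    the intersection of flats. *)
Definition rank_closure A : {set T} := [set e | rk (e |: A) <= rk A].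
Local Notation cl := rank_closure.

Lemma sub_rank_closure A : A \subset cl A.
Proof. by apply/subsetP=> e eA; rewrite inE (setUidPr _) ?sub1set. Qed.

Lemma mrank_closure A : rk (cl A) = rk A.
Proof.
rewrite -[RHS](@mrank_spanned A (cl A)) ?(setUidPr (sub_rank_closure A)) //.
by move=> e; rewrite inE.
Qed.

Lemma sub_closureE X A : (X \subset cl A) = (rk (A :|: X) <= rk A).
Proof.
apply/subsetP/idP => [H|H e eX]; first by rewrite mrank_spanned // => e /H; rewrite inE.
rewrite inE; apply: leq_trans H; apply: mrankS.
by rewrite subUset sub1set inE eX orbT subsetUl.
Qed.

Lemma flat_rank_closure A : flat Bs (cl A).
Proof.
apply/forallP=> e; apply/implyP; rewrite inE -ltnNge mrank_closure => H.
by apply: leq_trans H (mrankS _); apply/setUS/sub_rank_closure.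
Qed.

Lemma flatP G : reflect (cl G = G) (flat Bs G).
Proof.
apply: (iffP idP) => [/forallP fG|<-]; last exact: flat_rank_closure.
apply/eqP; rewrite eqEsubset sub_rank_closure andbT; apply/subsetP => e.
by rewrite inE; apply: contraLR => eG; have := fG e; rewrite eG /= -ltnNge.
Qed.

Lemma flat_closure_sub A G : flat Bs G -> A \subset G -> cl A \subset G.
Proof.
move=> /flatP fG sAG; rewrite -fG sub_closureE.
have := mrankU_incr (cl A) sAG; rewrite (setUidPr (sub_rank_closure A)) mrank_closure.
by rewrite addnC leq_add2l.
Qed.

Lemma mclosureE A : mclosure Bs A = cl A.
Proof.
apply/eqP; rewrite eqEsubset; apply/andP; split.
  by apply: bigcap_inf; rewrite flat_rank_closure sub_rank_closure.
by apply/bigcapsP=> G /andP[fG sG]; apply: flat_closure_sub.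
Qed.

Lemma flat_sub_mrank G X : flat Bs G -> (X \subset G) = (rk (G :|: X) <= rk G).
Proof. by move=> /flatP fG; rewrite -sub_closureE fG. Qed.

Lemma flat_mrank_lt G X : flat Bs G -> G \proper X -> rk G < rk X.
Proof.
move=> fG /andP[sGX nX]; rewrite ltnNge; apply: contra nX.
by rewrite (flat_sub_mrank _ fG) (setUidPr sGX).
Qed.

Lemma spanningE A : spanning Bs A = (rk A == rk setT).
Proof.
apply/existsP/eqP => [[B /andP[bB sB]]|e].
  apply/eqP; rewrite eqn_leq mrankS ?subsetT //.
  have [B' b' <-] := mrank_attained setT; rewrite setTI (card_basis b' bB).
  by apply: leq_trans (leq_mrank A bB); rewrite (setIidPr sB).
have [B bB rB] := mrank_attained A; exists B; rewrite bB /=.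
have: #|B| <= #|A :&: B| by rewrite rB e; have := leq_mrank setT bB; rewrite setTI.
move=> le; apply/setIidPr/eqP; rewrite eqEcard subsetIr //.
Qed.

(* The rank is strictly increasing along a chain of flats, so it numbers its
   members injectively by 1, ..., rk E - 1. *)
Lemma card_flat_chain (sg : {set {set T}}) : (rk [set: T] > 0) ->
  {in sg, forall G, [/\ flat Bs G, 0 < rk G & G != setT]} ->
  {in sg &, forall G G', (G \subset G') || (G' \subset G)} ->
  #|sg| < rk [set: T].
Proof.
move=> r0 fl ch.
have ltr G : G \in sg -> rk G < rk setT.
  by move=> /fl[fG _ nT]; apply: flat_mrank_lt; rewrite // properT.
have inj : {in sg &, injective rk}.
  move=> G G' iG iG' e; have [fG _ _] := fl _ iG; have [fG' _ _] := fl _ iG'.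
  apply/eqP/negPn/negP => ne; have [s|s] := orP (ch _ _ iG iG').
    by have := flat_mrank_lt fG (X := G'); rewrite properEneq ne s e ltnn => /(_ isT).
  by have := flat_mrank_lt fG' (X := G); rewrite properEneq eq_sym ne s e ltnn => /(_ isT).
pose f G : 'I_(rk setT).+1 := inord (rk G).
have vf G : G \in sg -> f G = rk G :> nat.
  by move=> /ltr /ltnW h; rewrite inordK.
rewrite -(card_in_imset (f := f)); last first.
  by move=> G G' iG iG' /(congr1 val); rewrite /= !vf //; apply: inj.
(* Of the [rk setT + 1] values of [f], both 0 and [rk setT] are missed. *)
have /subset_leq_card : f @: sg \subset ~: [set ord0; ord_max].
  apply/subsetP=> _ /imsetP[G iG ->]; rewrite !inE -!val_eqE /= vf //.
  by have [_ g0 _] := fl _ iG; rewrite negb_or -lt0n g0 /= neq_ltn ltr.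
have := cardsC [set (ord0 : 'I_(rk setT).+1); ord_max].
rewrite cards2 card_ord -val_eqE /= neq_ltn r0 => e le.
by move: le; rewrite -(leq_add2l 2) e.
Qed.

Hypothesis Hl : loopless Bs.

Lemma mrank_gt0 A : A != set0 -> 0 < rk A.
Proof.
case/set0Pn=> e eA; have [B bB eB] := Hl e.
by apply: leq_trans (leq_mrank A bB); apply/card_gt0P; exists e; rewrite inE eA.
Qed.

(** * Rank, flats and spanning sets of the principal truncation *)

Section Truncation.
Variables (S : {set T}).
Hypothesis HS : S != set0.
Local Notation F := (mclosure Bs S).
Local Notation tr := (trunc_bases Bs F).

Lemma sub_mclosure : S \subset F.
Proof. by rewrite mclosureE sub_rank_closure. Qed.

Lemma mrankU_mclosure A : rk (A :|: F) = rk (A :|: S).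
Proof.
apply/eqP; rewrite eqn_leq [X in _ && X]mrankS ?setUS ?sub_mclosure // andbT.
have := mrankU_incr A sub_mclosure; rewrite {2}mclosureE mrank_closure.
by rewrite leq_add2r setUC [S :|: A]setUC.
Qed.

(** The deleted [f] can be chosen outside [A] at no cost when [S] raises the rank of [A]; otherwise
    every choice costs one. Adding [S] or its closure to [A] gives the same rank, so the correction
    is [F subset of cl A]. *)
Lemma mrank_trunc A :
  mrank tr A = rk A - (rk (A :|: S) == rk A).
Proof.
apply/eqP; rewrite eqn_leq; apply/andP; split.
  apply/bigmax_leqP=> _ /imset2P[B f bB + ->]; rewrite inE => /andP[fB fF].
  have leA : #|A :&: (B :\ f)| <= #|A :&: B|.
    by apply/subset_leq_card/setIS/subsetDl.
  case: eqP => [e|_]; last by rewrite subn0 (leq_trans leA) // leq_mrank.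
  (* This set lies in the trace of [B] on [A :|: F], whose rank is that of [A]. Deleting [f] from it
     leaves at most [rk A - 1] elements. *)
  have le : #|f |: A :&: B| <= rk A.
    rewrite -e -mrankU_mclosure; apply: leq_trans (leq_mrank _ bB).
    apply/subset_leq_card/subsetP=> z; rewrite !inE.
    by case/orP=> [/eqP->|/andP[-> ->]] //; rewrite fF fB orbT.
  rewrite subn1 -ltnS (ltn_predK (m := 0)); last first.
    by apply: leq_trans le; apply/card_gt0P; exists f; rewrite setU11.
  apply: leq_trans le; rewrite (cardsD1 f (f |: _)) setU11 add1n ltnS.
  apply/subset_leq_card/subsetP=> z; rewrite !inE => /and3P[zA zf zB].
  by rewrite zf zA zB orbT.
have witness B f : B \in Bs -> f \in B -> f \in F -> #|A :&: (B :\ f)| <= mrank tr A.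
  by move=> bB fB fF; apply: leq_mrank; apply/imset2P; exists B f; rewrite ?inE ?fB.
case: eqP => [e|/eqP ne].
  (* A basis through [f] that is optimal for [f |: A] loses at most one element when [f] is
     deleted. *)
  have /set0Pn[f fS] := HS; have [B0 b0 f0] := Hl f.
  have [||B [bB fB rB]] := @mrank_attained_extension [set f] (f |: A) B0 b0.
  - by rewrite sub1set.
  - by rewrite sub1set setU11.
  rewrite sub1set in fB; apply: leq_trans _ (witness B f bB fB (subsetP sub_mclosure f fS)).
  rewrite leq_subLR; apply: leq_trans (mrankS (subsetUr [set f] A)) _.
  rewrite -rB (cardsD1 f (_ :&: _)); apply: leq_add; first by case: (_ \in _).
  apply/subset_leq_card/subsetP=> z; rewrite !inE => /and3P[zf + zB].
  by rewrite (negPf zf) zB => /= ->.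
rewrite subn0; have [B [bB rA rAS]] := mrank_attained2 (subsetUl A S).
have lt : #|A :&: B| < #|(A :|: S) :&: B|.
  by rewrite rA rAS ltn_neqAle eq_sym ne mrankS ?subsetUl.
(* The rank jump puts an element of [S] outside [A] into [B]; deleting it leaves [A :&: B]
   untouched. *)
have [f] : exists f, f \in ((A :|: S) :&: B) :\: A.
  apply/set0Pn; apply: contraTneq lt => /eqP; rewrite setD_eq0 => s.
  by rewrite -leqNgt; apply: subset_leq_card; rewrite subsetI s subsetIr.
rewrite !inE => /and3P[fA fAS fB]; rewrite (negPf fA) /= in fAS.
apply: leq_trans _ (witness B f bB fB (subsetP sub_mclosure f fAS)).
rewrite -rA; apply/subset_leq_card/subsetP=> z; rewrite !inE => /andP[zA ->].
by rewrite zA andbT; apply: contraNneq fA => <-.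
Qed.

Lemma flat_trunc G :
  flat tr G = flat Bs G && ((S \subset G) || ((rk G).+1 < rk (G :|: S))).
Proof.
have rS : 0 < rk S by apply: mrank_gt0.
have rU A : rk S <= rk (A :|: S) by apply/mrankS/subsetUr.
have mono A : rk A <= rk (A :|: S) by apply/mrankS/subsetUl.
apply/forallP/andP => [H|[fG HG] e].
  have fG : flat Bs G.
    apply/forallP=> e; apply/implyP=> eG; have := H e; rewrite eG /= !mrank_trunc.
    (* If [G] spans [S] then so does [e |: G], so the correction in [mrank_trunc] never drops and a
       strict increase must come from [rk]. *)
    have := mrankU_incr S (subsetUr [set e] G); have := mono G.
    have := mrankS (subsetUr [set e] G).
    have := rU G; have := rU (e |: G).
    by have := mono (e |: G); do 2 case: eqP; lia.
  split=> //; rewrite -implyNb; apply/implyP => /subsetPn[e eS eG].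
  (* Testing flatness at an element of [S] leaves [G :|: S] unchanged. A gap of exactly one would be
     closed by [e], and the correction would then cancel the increase. *)
  have eGS : e |: G :|: S = G :|: S.
    by rewrite -setUA (setUidPr _) // sub1set inE eS orbT.
  have := H e; rewrite eG /= !mrank_trunc eGS.
  have := mrankU1 e G; have := mono (e |: G); rewrite eGS.
  have : ~~ (S \subset G) by apply/subsetPn; exists e.
  rewrite (flat_sub_mrank _ fG).
  by do 2 case: eqP; lia.
apply/implyP=> eG; rewrite !mrank_trunc.
have := forallP fG e; rewrite eG /=; have := mrankU1 e G.
have [sSG|gap] := orP HG.
  have sSeG : S \subset e |: G by apply: subset_trans sSG (subsetUr _ _).
  by rewrite (setUidPl sSG) (setUidPl sSeG) !eqxx; have := rU G;
    rewrite (setUidPl sSG); lia.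
have := mrankS (setSU S (subsetUr [set e] G)).
by move: gap; do 2 case: eqP; lia.
Qed.

(** A spanning set of [H_bases S] omits at most one point, and that point lies in [S]. Hence the
    meet consists of spanning sets of M and of such sets with one point of [S] removed. *)
Lemma spanning_trunc : meet_spanning (H_bases S) Bs = [set A | spanning tr A].
Proof.
apply/setP=> A; rewrite inE; apply/imset2P/existsP.
  case=> A1 A2; rewrite !inE => /existsP[_ /andP[/imsetP[i iS ->] s1]].
  move=> /existsP[B /andP[bB s2]] ->.
  have [B0 b0 i0] := Hl i.
  (* A basis through [i] whose other elements lie in [A2]: they also lie in [A1], which contains
     everything except possibly [i]. *)
  rewrite -sub1set in i0; have [B' [b' iB' sB']] := basis_extension b0 i0 bB.
  exists (B' :\ i); apply/andP; split.
    apply/imset2P; exists B' i => //; rewrite inE -sub1set iB'.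
    exact: (subsetP sub_mclosure).
  apply/subsetP=> z; rewrite !inE => /andP[zi zB']; apply/andP; split.
    by apply: (subsetP s1); rewrite !inE.
  by apply: (subsetP s2); have := subsetP sB' z zB'; rewrite !inE (negPf zi).
case=> _ /andP[/imset2P[B f bB + ->] sA]; rewrite inE => /andP[fB fF].
have spB : rk (f |: A) = rk setT.
  apply/eqP; rewrite -spanningE; apply/existsP; exists B; rewrite bB /=.
  apply/subsetP=> z zB; rewrite !inE; case: eqP => //= /eqP zf.
  by apply: (subsetP sA); rewrite !inE zf.
(* If [A] spans [S], it spans [f], hence everything, and A = E ∩ A. Otherwise a point [i] of [S]
   outside the closure supplies the one missing rank, and A is the intersection of E \ i with
   [i |: A]. *)
have [sS|/subsetPn[i iS icl]] := boolP (S \subset rank_closure A).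
  have /set0Pn[i iS] := HS; exists setT A; rewrite ?inE ?setTI //.
    apply/existsP; exists (~: [set i]); rewrite subsetT andbT; exact: imset_f.
  rewrite spanningE -spB eqn_leq mrankS ?subsetUr //=.
  have sF : F \subset rank_closure A.
    by rewrite mclosureE flat_closure_sub ?flat_rank_closure.
  by have := subsetP sF f fF; rewrite inE.
rewrite inE -ltnNge in icl; exists (~: [set i]) (i |: A); rewrite ?inE.
- by apply/existsP; exists (~: [set i]); rewrite subxx andbT; exact: imset_f.
- rewrite spanningE eqn_leq mrankS ?subsetT //= -spB.
  exact: leq_trans (mrankU1 _ _) icl.
apply/setP=> z; rewrite !inE; case: eqP => //= ->; apply/negP=> iA.
by rewrite (setUidPr _) ?sub1set // ltnn in icl.
Qed.

End Truncation.
End MatroidRank.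

(** * Cones of flats and their refinements *)

Section FlatChains.
Set Implicit Arguments.
Unset Strict Implicit.
Local Open Scope nat_scope.
Variables (n : nat) (Bs : {set {set 'I_n.+1}}).
Hypotheses (HM : is_matroid Bs) (Hl : loopless Bs).
Implicit Types (S T G X : {set 'I_n.+1}) (sg : {set {set 'I_n.+1}}).
Local Notation rk := (mrank Bs).
Local Notation cl := (rank_closure Bs).

Lemma coneP sg : reflect ({in sg, forall X : {set _}, ray X} /\
    {in sg &, forall X Y : {set _}, (X \subset Y) || (Y \subset X)}) (is_cone sg).
Proof.
apply: (iffP andP) => [[/'forall_implyP H1 /'forall_implyP H2]|[H1 H2]].
  by split=> // X Y /H2/'forall_implyP; apply.
split; first by apply/'forall_implyP.
by apply/'forall_implyP => X iX; apply/'forall_implyP => Y; apply: H2.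
Qed.

Lemma cone_setU1 sg X : is_cone sg -> ray X ->
  {in sg, forall Y : {set _}, (X \subset Y) || (Y \subset X)} -> is_cone (X |: sg).
Proof.
move=> /coneP[H1 H2] rX H; apply/coneP; split=> [Y|Y Z]; rewrite !inE.
  by case/predU1P=> [->//|]; apply: H1.
move=> /predU1P[->|iY] /predU1P[->|iZ]; rewrite ?subxx ?H //.
  by rewrite orbC H.
exact: H2.
Qed.

Lemma card_flat_cone sg : is_cone sg -> [forall X in sg, flat Bs X] -> #|sg| < rk setT.
Proof.
move=> /coneP[H1 H2] /'forall_implyP H3; apply: card_flat_chain => //.
  by apply: mrank_gt0 => //; apply/set0Pn; exists ord0.
by move=> X iX; have /andP[X0 XT] := H1 X iX; rewrite H3 // mrank_gt0.
Qed.

Lemma largest_avoiding sg S : is_cone sg -> S != set0 ->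
  exists G, [/\ G \in set0 |: sg, ~~ (S \subset G) &
    {in sg, forall X : {set _}, ~~ (S \subset X) -> X \subset G}].
Proof.
move=> /coneP[_ ch] S0.
pose P X := (X \in set0 |: sg) && ~~ (S \subset X).
have P0 : P set0 by rewrite /P setU11 subset0.
case: (arg_maxnP (fun X => #|X|) P0) => G /andP[iG nG] maxG.
exists G; split=> // X iX nX; move: (maxG X); rewrite /P inE iX orbT nX => /(_ isT) le.
case/setU1P: iG => [G0|iG].
  by move: le; rewrite G0 /= cards0 leqn0 cards_eq0 => /eqP->.
have /orP[//|sGX] := ch X G iX iG.
by have /eqP <- : G == X by rewrite eqEcard sGX.
Qed.

Section Avoiding.
Variables (sg : {set {set 'I_n.+1}}) (S G : {set 'I_n.+1}) (a : 'I_n.+1).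
Hypotheses (cs : is_cone sg) (fs : [forall X in sg, flat Bs X])
  (iG : G \in set0 |: sg) (nSG : ~~ (S \subset G))
  (maxG : {in sg, forall X : {set _}, ~~ (S \subset X) -> X \subset G})
  (aS : a \in S) (aG : a \notin G).

Lemma flat_avoiding : flat Bs G.
Proof.
case/setU1P: iG => [->|]; last by move/'forall_implyP: fs; apply.
apply/forallP=> e; apply/implyP=> _; rewrite mrank0 // mrank_gt0 //.
by apply/set0Pn; exists e; rewrite setU11.
Qed.

(** Any admissible [T] contains both [a] and [G], hence their closure. A strict inclusion would let
    both sets refine [sg], giving a chain of flats that is too long. *)
Lemma unique_flat_refinement T : #|sg|.+2 = rk setT ->
  [&& ray T, a \in T, ~~ (S \subset T), is_cone (T |: sg) &
      [forall X in T |: sg, flat Bs X]] =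
  ((T == cl (a |: G)) && ~~ (S \subset cl (a |: G))).
Proof.
move=> cardsg; set T0 := cl _.
have aT0 : a \in T0 by rewrite (subsetP (sub_rank_closure Bs _)) ?setU11.
have GT0 : G \subset T0 by apply: subset_trans (sub_rank_closure Bs _); apply: subsetUr.
have fT0 : flat Bs T0 by apply: flat_rank_closure.
have rT0 : ~~ (S \subset T0) -> ray T0.
  move=> nS; apply/andP; split; first by apply/set0Pn; exists a.
  by apply: contraNneq nS => ->; apply: subsetT.
(* Members avoiding [S] lie below [G]; members containing [S] contain [a] and, by comparability,
   [G]. *)
have cT0 : {in sg, forall X : {set _}, (T0 \subset X) || (X \subset T0)}.
  move=> X iX; have [sX|/(maxG iX) sXG] := boolP (S \subset X); last first.
    by rewrite (subset_trans sXG GT0) orbT.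
  rewrite flat_closure_sub //; first by move/'forall_implyP: fs; apply.
  rewrite subUset sub1set (subsetP sX) //=.
  case/setU1P: (iG) => [->|iG']; first exact: sub0set.
  move/coneP: (cs) => [_ /(_ _ _ iX iG') /orP[sXG|//]].
  by case/negP: nSG; apply: subset_trans sX sXG.
apply/and5P/andP => [[rT aT nT cT fT]|[/eqP-> nS]]; last first.
  split=> //; first exact: rT0; first by apply: cone_setU1 => //; apply: rT0.
  apply/'forall_implyP=> X /setU1P[->//|]; by move/'forall_implyP: fs; apply.
have flT : flat Bs T by move/'forall_implyP: fT; apply; rewrite setU11.
have sT0T : T0 \subset T.
  apply: flat_closure_sub => //; rewrite subUset sub1set aT /=.
  case/setU1P: (iG) => [->|iG']; first exact: sub0set.
  move/coneP: cT => [_ /(_ T G)]; rewrite !inE eqxx iG' orbT => /(_ isT isT).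
  by case/orP=> // /subsetP/(_ a aT); rewrite (negPf aG).
have nS : ~~ (S \subset T0) by apply: contra nT => sS; apply: subset_trans sS sT0T.
split=> //; apply/negPn/negP=> neT.
have notin (Y : {set _}) : a \in Y -> ~~ (S \subset Y) -> Y \notin sg.
  by move=> aY nY; apply/negP=> /maxG/(_ nY)/subsetP/(_ a aY); rewrite (negPf aG).
(* With [T] and [T0] both new, this would be a cone of [rk setT] flats, one more than
   [card_flat_cone] allows. *)
have := @card_flat_cone (T0 |: (T |: sg)).
rewrite !cardsU1 !inE negb_or eq_sym neT !notin //= !add1n cardsg ltnn => H.
suff: false by []; apply: H.
  apply: cone_setU1 => //; first exact: rT0.
  by move=> X /setU1P[->|/cT0//]; rewrite sT0T.
apply/'forall_implyP=> X /setU1P[->//|]; by move/'forall_implyP: fT; apply.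
Qed.

(** Since [G] is flat, [a] raises its rank by exactly one, so the right-hand side says that [S]
    raises it by at least two. This is the condition of [flat_trunc] at [G], the most restrictive
    member. *)
Lemma trunc_flat_chain :
  (1 < rk S) && [forall X in sg, flat (trunc_bases Bs (mclosure Bs S)) X] =
  ~~ (S \subset cl (a |: G)).
Proof.
have S0 : S != set0 by apply/set0Pn; exists a.
rewrite sub_closureE // -setUA [G :|: S]setUC setUA.
rewrite (setUidPr (_ : [set a] \subset S)) ?sub1set // [S :|: G]setUC.
have fG := flat_avoiding.
have rG : rk (a |: G) = (rk G).+1.
  by apply/eqP; rewrite eqn_leq mrankU1 //; move/forallP/(_ a): fG; rewrite aG.
rewrite rG -ltnNge; apply/andP/idP => [[rS /'forall_implyP H]|H].
  case/setU1P: iG => [->|/H]; first by rewrite set0U mrank0.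
  by rewrite flat_trunc // (negPf nSG) => /andP[].
(* By diminishing returns the gap at [G] passes to its subsets: the members of [sg] below [G], and
   the empty set, where it reads [1 < rk S]. *)
have gap X : X \subset G -> (rk X).+1 < rk (X :|: S).
  by move=> sXG; have := mrankU_incr HM S sXG; lia.
split; first by have := gap set0 (sub0set _); rewrite set0U mrank0.
apply/'forall_implyP=> X iX; rewrite flat_trunc //.
have -> /= : flat Bs X by move/'forall_implyP: fs; apply.
by have [//|/(maxG iX)/gap] := boolP (S \subset X).
Qed.

End Avoiding.
End FlatChains.

(** * Evaluating the weight functional on products with a divisor *)

Section Functional.
Set Implicit Arguments.
Unset Strict Implicit.
Variables (R : comNzRingType) (n d : nat).
Local Notation P := {mpoly R[#|{set 'I_n.+1}|]}.
Variables (Delta : {set {set 'I_n.+1}} -> R) (L : P -> R).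
Hypothesis HL : weight_functional Delta d L.
Implicit Types (S T : {set 'I_n.+1}) (sg : {set {set 'I_n.+1}}) (p q g : P).

Lemma functionalD p q : L (p + q) = L p + L q.
Proof. by case: HL => lin _; rewrite -{1}[p]scale1r lin mul1r. Qed.

Lemma functional0 : L 0 = 0.
Proof. by apply: (addrI (L 0)); rewrite -functionalD !addr0. Qed.

Lemma functional_sum (I : finType) (A : pred I) (f : I -> P) :
  L (\sum_(i | A i) f i) = \sum_(i | A i) L (f i).
Proof. exact: (big_morph L functionalD functional0). Qed.

Lemma functional_gen p g : chow_gen g -> p * g \is d.-homog -> L (p * g) = 0.
Proof.
case: HL => _ [H _] cg hp; apply: H => //.
exists [:: (p, g)]; split; last by rewrite big_seq1.
by move=> q; rewrite inE => /eqP->.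
Qed.

Lemma xv_homog T : xv R T \is 1.-homog.
Proof. by rewrite dhomogX /= mdeg1. Qed.

Lemma xmono_homog sg : xmono R sg \is #|sg|.-homog.
Proof.
rewrite /xmono -sum1_card.
elim/big_rec2: _ => [|T k p _ hp]; first exact: dhomog1.
by apply: dhomogM => //; apply: xv_homog.
Qed.

Lemma functional_linear_gen sg (m : 'I_n.+1 -> int) :
  #|sg|.+1 = d -> \sum_j m j = 0 ->
  L ((\sum_(T : {set 'I_n.+1} | ray T) (\sum_(j in T) m j)%:~R *: xv R T)
     * xmono R sg) = 0.
Proof.
move=> cd m0; rewrite mulrC functional_gen //.
  by right; left; exists m.
rewrite -cd -[#|sg|.+1]addn1; apply: dhomogM; first exact: xmono_homog.
by apply: rpred_sum => T _; apply: rpredZ; apply: xv_homog.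
Qed.

(** If [T |: sg] is not a cone, its monomial is one of the non-face generators of the ideal, since
    all its members are rays. *)
Lemma functional_xvM T sg : #|sg|.+1 = d -> is_cone sg -> ray T -> T \notin sg ->
  L (xv R T * xmono R sg) = if is_cone (T |: sg) then Delta (T |: sg) else 0.
Proof.
move=> cd cs rT nT.
have -> : xv R T * xmono R sg = xmono R (T |: sg) by rewrite /xmono big_setU1.
have cU : #|T |: sg| = d by rewrite cardsU1 nT add1n.
have [cT|nc] := boolP (is_cone _); first by case: HL => _ [_]; apply.
rewrite -[xmono _ _]mul1r functional_gen //.
  left; exists (T |: sg); rewrite nc andbT; split=> //.
  apply/'forall_implyP=> X /setU1P[->//|iX].
  by case/coneP: cs => H _; apply: H.
by rewrite mul1r -cU; apply: xmono_homog.
Qed.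

Lemma alphaE (i : 'I_n.+1) : alpha R i =
  \sum_(T : {set 'I_n.+1} | ray T && (i \in T)) xv R T.
Proof.
apply: eq_bigl => T; rewrite /ray; case: (T =P set0) => [->|_] /=; first by rewrite inE.
by rewrite andbC.
Qed.

(** The difference is the linear relation attached to the dual vector e_i^* - e_a^*, whose
    coordinates sum to zero. *)
Lemma alpha_subE (i a : 'I_n.+1) : alpha R i - alpha R a =
  \sum_(T : {set 'I_n.+1} | ray T)
    (\sum_(j in T) ((j == i)%:Z - (j == a)%:Z))%:~R *: xv R T.
Proof.
have sumE (T : {set 'I_n.+1}) (b : 'I_n.+1) : \sum_(j in T) (j == b)%:Z = (b \in T).
  have [bT|bT] := boolP (b \in T).
    by rewrite (bigD1 b) //= eqxx big1 ?addr0 // => j /andP[_ /negPf->].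
  by rewrite big1 // => j jT; case: eqP bT => // <-; rewrite jT.
rewrite !alphaE !big_mkcondr /= -sumrB; apply: eq_bigr => T _.
rewrite sumrB !sumE intrD rmorphN /= scalerBl.
by case: (T != setT); case: (i \in T); case: (a \in T); rewrite ?scale1r ?scale0r ?subr0.
Qed.

(* As alpha does not depend on i, it may be evaluated at any a in S; the terms
   with S contained in T then cancel, and the remaining ones are square-free
   when a avoids every member of sg not containing S. *)
Lemma functional_hdiv S (i a : 'I_n.+1) sg : #|sg|.+1 = d -> a \in S ->
  L (hdiv R S i * xmono R sg) =
  \sum_(T : {set 'I_n.+1} | [&& ray T, a \in T & ~~ (S \subset T)])
     L (xv R T * xmono R sg).
Proof.
move=> cd aS.
have -> : hdiv R S i = (alpha R i - alpha R a) + hdiv R S a.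
  by rewrite /hdiv addrA subrK.
have -> : hdiv R S a =
    \sum_(T : {set 'I_n.+1} | [&& ray T, a \in T & ~~ (S \subset T)]) xv R T.
  rewrite /hdiv alphaE (bigID (fun T => S \subset T)) /=.
  rewrite (eq_bigl (fun T : {set _} => (S \subset T) && (T != setT))).
    by rewrite addrC addrK; apply: eq_bigl => T; rewrite andbA.
  move=> T; rewrite /ray; case sST: (S \subset T); rewrite ?andbF //= (subsetP sST) // !andbT.
  suff -> : T != set0 by [].
  by apply/set0Pn; exists a; apply: (subsetP sST).
rewrite mulrDl functionalD alpha_subE functional_linear_gen //; last first.
  by rewrite sumrB (bigD1 i) // (bigD1 a (P := predT)) //= !eqxx !big1 // => j /negPf->.
by rewrite add0r mulr_suml functional_sum.
Qed.

End Functional.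

(** * The intersection with H_S and the cap product formula *)

Theorem theorem3p11 (R : realFieldType) (n : nat)
    (Bs : {set {set 'I_n.+1}}) (HM : is_matroid Bs) (Hl : loopless Bs)
    (S : {set 'I_n.+1}) (HS : S != set0) :
  let F := mclosure Bs S in
  let r := mrank Bs setT in
  meet_spanning (H_bases S) Bs = [set A | spanning (trunc_bases Bs F) A] /\
  forall L : {mpoly R[#|{set 'I_n.+1}|]} -> R,
    weight_functional (bergman R Bs) r.-1 L ->
    forall (i : 'I_n.+1) (sg : {set {set 'I_n.+1}}),
      is_cone sg -> #|sg|.+2 = r ->
      L (hdiv R S i * xmono R sg) =
        (if (1 < mrank Bs S)%N then bergman R (trunc_bases Bs F) sg else 0).
Proof.
split; first exact: spanning_trunc.
move=> L HL i sg cs cardsg.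
have cd : (#|sg|.+1 = (mrank Bs setT).-1)%N by rewrite -cardsg.
have [G [iG nSG maxG]] := largest_avoiding cs HS.
have /subsetPn[a aS aG] := nSG.
rewrite (functional_hdiv HL i cd aS).
(* Members of [sg] avoiding [S] lie in [G], which misses [a]; so every monomial below is
   square-free. *)
have notin (T : {set 'I_n.+1}) : a \in T -> ~~ (S \subset T) -> T \notin sg.
  by move=> aT nT; apply/negP=> /maxG/(_ nT)/subsetP/(_ a aT); rewrite (negPf aG).
have valE (T : {set 'I_n.+1}) : [&& ray T, a \in T & ~~ (S \subset T)] ->
    L (xv R T * xmono R sg) =
    if is_cone (T |: sg) && [forall X in T |: sg, flat Bs X] then 1 else 0.
  move=> /and3P[rT aT nT]; rewrite (functional_xvM HL) ?notin //.
  by case: is_cone.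
rewrite (eq_bigr _ valE) -big_mkcondr /=.
(* If some member of [sg] is not a flat of M, both sides vanish, because flats of the truncation are
   flats of M. *)
have [fs|nfs] := boolP [forall X in sg, flat Bs X]; last first.
  rewrite big_pred0 => [|T]; last first.
    apply: contraNF nfs => /andP[_ /andP[_ fT]]; move/'forall_implyP: fT => H.
    by apply/'forall_implyP=> X iX; apply: H; rewrite inE iX orbT.
  have /negPf nft : ~~ [forall X in sg, flat (trunc_bases Bs (mclosure Bs S)) X].
    apply: contra nfs => ft; apply/'forall_implyP=> X iX.
    by move/'forall_implyP/(_ X iX): ft; rewrite flat_trunc // => /andP[].
  by rewrite /bergman nft if_same.
have uniq T := unique_flat_refinement HM Hl cs fs iG nSG maxG aS aG T cardsg.
rewrite (eq_bigl (fun T => (T == rank_closure Bs (a |: G)) &&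
    ~~ (S \subset rank_closure Bs (a |: G)))); last first.
  by move=> T; rewrite -uniq !andbA.
(* The sum has at most one term, and the condition for that term is the one under which the
   right-hand side equals 1. *)
have := trunc_flat_chain HM Hl cs fs iG nSG maxG aS aG.
rewrite /bergman; case: (S \subset _) => /=.
  rewrite big_pred0 => [|T]; last by rewrite andbF.
  by case: ltnP => //= _ ->.
rewrite (eq_bigl (pred1 (rank_closure Bs (a |: G)))) => [|T]; last by rewrite andbT.
by rewrite big_pred1_eq; case: ltnP => //= _ ->.
Qed.
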